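(* Let $G$ be a countable amenable group and let $A\subseteq G\times G$ satisfy $d^*_l(A)>0$. Then for any left or right Følner sequence $F$ in $G$ there exists $B\subseteq G$ such that $\overline{d}_F(B)\geq d^*_l(A)^2$ and $B\times B\subseteq AA^{-1}$.
   Context: ''Countable'' means in bijective correspondence with $\mathbb{N}$. A left Følner sequence in a countable group $G$ is a sequence $(F_N)_{N\in\mathbb{N}}$ of finite nonempty subsets of $G$ such that $\lim_{N\to\infty}\frac{|gF_N\Delta F_N|}{|F_N|}=0$ for all $g\in G$; it is a right Følner sequence if $\lim_{N\to\infty}\frac{|F_Ng\Delta F_N|}{|F_N|}=0$ for all $g\in G$. $G$ is amenable if it has a left Følner sequence (equivalently, a right one). For a sequence $F=(F_N)$ of finite nonempty subsets of $G$ and $E\subseteq G$, $\overline{d}_F(E)=\limsup_{N\to\infty}\frac{|E\cap F_N|}{|F_N|}$. The left upper Banach density of a subset $E$ of a countable amenable group $K$ is $d^*_l(E)=\sup\{\overline{d}_F(E): F\text{ a left Følner sequence in }K\}$; here $d^*_l(A)$ is taken in $K=G\times G$. $AA^{-1}=\{xy^{-1}:x,y\in A\}$, computed in the group $G\times G$. *)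

(* Defs.v *)
From HB Require Import structures.
From mathcomp Require Import all_boot all_order all_algebra finmap.
From mathcomp Require Import all_classical all_reals all_analysis.
Import Order.TTheory GRing.Theory Num.Theory.
Import numFieldNormedType.Exports.

Set Implicit Arguments.
Unset Strict Implicit.
Unset Printing Implicit Defensive.

Local Open Scope classical_set_scope.
Local Open Scope ring_scope.

(* Groups are [groupType]s (possibly infinite); a product of two of them carries
   the componentwise group structure. *)

(* In bijection with the natural numbers; this excludes finite groups. *)
Definition countably_infinite (T : Type) : Prop := ([set: T] #= [set: nat])%card.

Definition fsymdiff (T : choiceType) (A B : {fset T}) : {fset T} :=
  ((A `\` B) `|` (B `\` A))%fset.

Definition ltranslate (G : groupType) (g : G) (A : {fset G}) : {fset G} :=
  [fset (g * x)%g | x in A]%fset.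

Definition rtranslate (G : groupType) (A : {fset G}) (g : G) : {fset G} :=
  [fset (x * g)%g | x in A]%fset.

Definition left_Folner (R : realType) (G : groupType) (F : nat -> {fset G}) : Prop :=
  (forall N, F N != fset0) /\
  forall g : G,
    (#|` fsymdiff (ltranslate g (F N)) (F N)|%:R / #|` F N|%:R : R)
      @[N --> \oo] --> (0 : R).

Definition right_Folner (R : realType) (G : groupType) (F : nat -> {fset G}) : Prop :=
  (forall N, F N != fset0) /\
  forall g : G,
    (#|` fsymdiff (rtranslate (F N) g) (F N)|%:R / #|` F N|%:R : R)
      @[N --> \oo] --> (0 : R).

Definition amenable (R : realType) (G : groupType) : Prop :=
  exists F : nat -> {fset G}, left_Folner R F.

(* Densities are extended reals, so that the limit superior and the supremum are
   the order-theoretic ones without any boundedness or nonemptiness condition. *)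
Definition upper_density (R : realType) (G : groupType) (F : nat -> {fset G})
    (E : set G) : \bar R :=
  limn_esup (fun N =>
    (#|` [fset x in F N | x \in E]%fset|%:R / #|` F N|%:R : R)%:E).

Definition left_upper_Banach_density (R : realType) (G : groupType)
    (E : set G) : \bar R :=
  ereal_sup [set upper_density R F E | F in [set F | left_Folner R F]].

Definition AAinv (G : groupType) (A : set G) : set G :=
  [set (x * y^-1)%g | x in A & y in A].

(* Main.v *)
Require Import Defs.
From HB Require Import structures.
From mathcomp Require Import all_boot all_order all_algebra finmap.
From mathcomp Require Import all_classical all_reals all_analysis.
From mathcomp Require Import ring lra.
Import Order.TTheory GRing.Theory Num.Theory.
Import numFieldNormedType.Exports.
Local Open Scope classical_set_scope.
Local Open Scope ring_scope.

(** Write [d] for the left upper Banach density of [A].  The proof is Furstenberg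
    correspondence with finitely additive means in place of measures.

    For a base point [x] of [G * G] put
      [returns A x = {b | A ((b, 1) * x) and A ((1, b^-1) * x)}].
    The quotient of [(b1, 1) * x] by [(1, b2^-1) * x] is [(b1, b2)], so the square of
    [returns A x] lies in [AAinv A] ([returns_AAinv]).  It remains to choose base
    points for which this set is large along [F].

    Limits of averages along ultrafilters give a left-invariant mean [m] on [G * G]
    with [a = m \1_A >= d] ([left_upper_Banach_density_mean]).  By invariance, the
    mean over [x] of the event [b \in returns A x] is the diagonal correlation
    [phi b = m (\1_A x * \1_A ((b, b) * x))].  The averages of [phi] along a left or
    right Følner sequence have limit superior at least [a ^+ 2]
    ([large_average_correlation]): shifting [phi] by any group element does not
    change them asymptotically, so a failure would produce arbitrarily many
    functions of mean [a] with pairwise correlations below [a ^+ 2 - e], which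
    Cauchy-Schwarz forbids ([large_correlation]).

    Hence the relative size [f N x] of [returns A x] in [F N] has mean at least
    [a ^+ 2 - e] for infinitely many [N].  With a countably additive measure, the
    reverse Fatou lemma would give one point [x] where the limit superior of [f N x]
    is at least [a ^+ 2].  For a mean one gets instead indices [N i] and points [x k]
    such that [f (N i) (x k) >= a ^+ 2 - 1 / (i + 1)] whenever [i <= k]
    ([recurrent_points]).  The limit [B] of the sets [returns A (x k)] along an
    ultrafilter agrees on each [F (N i)] with [returns A (x k)] for some [k >= i], so
    its upper density is at least [a ^+ 2]; and any two of its elements lie in a
    common [returns A (x k)], so [B `*` B `<=` AAinv A]. *)

Set Implicit Arguments.
Unset Strict Implicit.
Unset Printing Implicit Defensive.

(** * Finitely additive means *)

Definition bdd (R : realType) (X : Type) (f : X -> R) : Prop :=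
  exists C, forall x, `|f x| <= C.

(** Only the values on bounded functions are constrained, because ultrafilter limits
    exist only there. *)
Record is_mean (R : realType) (X : Type) (m : (X -> R) -> R) : Prop := IsMean {
  mean_linear : forall c f g, bdd f -> bdd g ->
    m (fun x => c * f x + g x) = c * m f + m g;
  mean_ge0 : forall f, bdd f -> (forall x, 0 <= f x) -> 0 <= m f;
  mean1 : m (fun=> 1) = 1 }.

Section BoundedFunctions.
Variables (R : realType) (X : Type).
Implicit Types f g : X -> R.

Lemma bdd_cst c : bdd (fun _ : X => c : R).
Proof. by exists `|c|. Qed.

Lemma bddD f g : bdd f -> bdd g -> bdd (fun x => f x + g x).
Proof.
move=> [C fC] [D gD]; exists (C + D) => x.
by rewrite (le_trans (ler_normD _ _))// lerD.
Qed.

Lemma bddM f g : bdd f -> bdd g -> bdd (fun x => f x * g x).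
Proof.
move=> [C fC] [D gD]; exists (C * D) => x.
by rewrite normrM ler_pM.
Qed.

Lemma bddN f : bdd f -> bdd (fun x => - f x).
Proof. by move=> [C fC]; exists C => x; rewrite normrN. Qed.

Lemma bdd_sum (I : Type) (s : seq I) (f : I -> X -> R) :
  (forall i, bdd (f i)) -> bdd (fun x => \sum_(i <- s) f i x).
Proof.
move=> bf; elim: s => [|i s IH].
  by under eq_fun do rewrite big_nil; exact: bdd_cst.
by under eq_fun do rewrite big_cons; exact: bddD.
Qed.

Lemma bdd_unit f : (forall x, 0 <= f x <= 1) -> bdd f.
Proof. by move=> f01; exists 1 => x; rewrite ger0_norm; case/andP: (f01 x). Qed.

Lemma bdd_comp (Y : Type) (h : Y -> X) f : bdd f -> bdd (fun y => f (h y)).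
Proof. by move=> [C fC]; exists C. Qed.

Lemma indic_itv (D : set X) x : 0 <= (\1_D x : R) <= 1.
Proof. by rewrite indicE; case: (_ \in _); rewrite ?ler01 ?lexx. Qed.

Lemma bdd_indic (D : set X) : bdd (\1_D : X -> R).
Proof. by apply: bdd_unit => x; exact: indic_itv. Qed.

End BoundedFunctions.

#[local] Hint Resolve bdd_cst bddD bddM bddN bdd_sum bdd_indic : core.

Section MeanTheory.
Variables (R : realType) (X : Type) (m : (X -> R) -> R).
Hypothesis mm : is_mean m.
Implicit Types f g : X -> R.

Lemma mean0 : m (fun=> 0) = 0.
Proof.
have := mean_linear mm (-1) (bdd_cst X 1) (bdd_cst X 1).
by under eq_fun do rewrite mulr1 addNr; move=> ->; rewrite mulN1r addNr.
Qed.

Lemma meanZ c f : bdd f -> m (fun x => c * f x) = c * m f.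
Proof.
move=> bf; have := mean_linear mm c bf (bdd_cst X 0).
by under eq_fun do rewrite addr0; move=> ->; rewrite mean0 addr0.
Qed.

Lemma mean_cst c : m (fun=> c) = c.
Proof.
have := meanZ c (bdd_cst X 1).
by under eq_fun do rewrite mulr1; move=> ->; rewrite mean1 // mulr1.
Qed.

Lemma meanD f g : bdd f -> bdd g -> m (fun x => f x + g x) = m f + m g.
Proof.
move=> bf bg; have := mean_linear mm 1 bf bg.
by under eq_fun do rewrite mul1r; rewrite mul1r.
Qed.

Lemma meanB f g : bdd f -> bdd g -> m (fun x => f x - g x) = m f - m g.
Proof.
move=> bf bg; have := mean_linear mm (-1) bg bf.
by under eq_fun do rewrite mulN1r addrC; move=> ->; rewrite mulN1r addrC.
Qed.

Lemma mean_sum (I : Type) (s : seq I) (f : I -> X -> R) :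
  (forall i, bdd (f i)) ->
  m (fun x => \sum_(i <- s) f i x) = \sum_(i <- s) m (f i).
Proof.
move=> bf; elim: s => [|i s IH].
  by under eq_fun do rewrite big_nil; rewrite mean0 big_nil.
by under eq_fun do rewrite big_cons; rewrite meanD ?IH ?big_cons//; exact: bdd_sum.
Qed.

Lemma mean_le f g : bdd f -> bdd g -> (forall x, f x <= g x) -> m f <= m g.
Proof.
move=> bf bg fg; rewrite -subr_ge0 -meanB//; apply: mean_ge0 => //.
  by apply: bddD => //; exact: bddN.
by move=> x; rewrite subr_ge0.
Qed.

Lemma mean_norm f C : (forall x, `|f x| <= C) -> `|m f| <= C.
Proof.
move=> fC; have bf : bdd f by exists C.
rewrite ler_norml -{1}(mean_cst (- C)) -{2}(mean_cst C).
by apply/andP; split; apply: mean_le => // x; have := fC x;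
  rewrite ler_norml => /andP[].
Qed.

Lemma mean_gt0_ex f : bdd f -> 0 < m f -> exists x, 0 < f x.
Proof.
move=> bf mf; apply: contrapT => /forallNP f0; move: mf; apply/negP.
rewrite -leNgt -mean0; apply: mean_le => // x.
by rewrite leNgt; apply/negP/f0.
Qed.

(** Cauchy-Schwarz against a constant: the variance of [f] under [m] is nonnegative. *)
Lemma mean_sqr f : bdd f -> m f ^+ 2 <= m (fun x => f x ^+ 2).
Proof.
move=> bf.
have bf2 : bdd (fun x => f x ^+ 2) by exact: bddM.
have := mean_ge0 mm (f := fun x => (-2 * m f) * f x + (f x ^+ 2 + m f ^+ 2)).
rewrite mean_linear ?meanD ?mean_cst//; last exact: bddD.
move=> H; rewrite -subr_ge0.
suff : 0 <= -2 * m f * m f + (m (fun x => f x ^+ 2) + m f ^+ 2) by nra.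
apply: H.
  by apply: bddD; [apply: bddM|apply: bddD].
move=> x; have := sqr_ge0 (f x - m f); nra.
Qed.

End MeanTheory.

(** * Averages over finite sets and limits along ultrafilters *)

Definition avg (R : realType) (X : choiceType) (S : {fset X}) (f : X -> R) : R :=
  (\sum_(x <- S) f x) / #|`S|%:R.

Definition ulim (R : realType) (I : Type) (U : set_system I) (u : I -> R) : R :=
  lim (u i @[i --> U]).

Section Averages.
Variables (R : realType) (X : choiceType).
Implicit Types (S : {fset X}) (f : X -> R).

Lemma card_gt0R S : S != fset0 -> 0 < (#|`S|%:R : R).
Proof. by rewrite ltr0n cardfs_gt0. Qed.

Lemma avg_mean S : S != fset0 -> is_mean (@avg R X S).
Proof.
move=> /card_gt0R S0; split.
- by move=> c f g _ _; rewrite /avg big_split/= -mulr_sumr mulrDl mulrA.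
- by move=> f _ f0; rewrite divr_ge0// sumr_ge0.
- rewrite /avg big_const_seq count_predT iter_addr_0 -mulr_natl mulr1 divff//.
  exact: lt0r_neq0.
Qed.

End Averages.

Section UltraLimits.
Variables (R : realType) (I : Type) (U : set_system I).
Hypothesis UU : UltraFilter U.

Lemma ultra_fmap (Y : Type) (u : I -> Y) : UltraFilter (u @ U).
Proof.
split; first exact: fmap_proper_filter.
move=> G PG uG; apply/seteqP; split=> // A GA.
have [//|UnA] := in_ultra_setVsetC (u @^-1` A) UU.
have GnA : G (~` A) by exact: uG.
have [y []] := filter_ex (filterI GA GnA).
exact.
Qed.

Lemma cvg_ulim (u : I -> R) : bdd u -> u i @[i --> U] --> ulim U u.
Proof.
move=> [C uC].
have := @segment_compact R (- C) C; rewrite compact_ultra => cC.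
have [|p [_ up]] := cC (u @ U) (ultra_fmap u); last by apply: (cvgP p).
by apply: (@filterE _ U) => i; rewrite /= in_itv/= -ler_norml.
Qed.

Lemma ulim_eq (u : I -> R) l : u i @[i --> U] --> l -> ulim U u = l.
Proof. by move=> ul; apply: cvg_lim => //; exact: Rhausdorff. Qed.

(** Bounded families always converge along an ultrafilter, so pointwise limits
    of means exist and remain linear and positive. *)
Lemma ulim_mean (X : Type) (m : I -> (X -> R) -> R) :
  (forall i, is_mean (m i)) -> is_mean (fun f => ulim U (fun i => m i f)).
Proof.
move=> mm.
have bm f : bdd f -> bdd (fun i => m i f).
  by move=> [C fC]; exists C => i; exact: (mean_norm (mm i)).
split.
- move=> c f g bf bg; apply: ulim_eq.
  under eq_fun do rewrite (mean_linear (mm _))//.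
  by apply: cvgD; [apply: cvgM; first exact: cvg_cst|]; apply/cvg_ulim/bm.
- move=> f bf f0; apply: limr_ge; first by apply/cvg_ex; eexists; apply/cvg_ulim/bm.
  by apply: filterE => i; exact: (mean_ge0 (mm i)).
- by apply: ulim_eq; under eq_fun do rewrite (mean1 (mm _)); exact: cvg_cst.
Qed.

End UltraLimits.

Lemma mean_avg (R : realType) (X : Type) (I : choiceType) (m : (X -> R) -> R)
    (S : {fset I}) (f : I -> X -> R) : is_mean m -> (forall i, bdd (f i)) ->
  m (fun x => avg S (f^~ x)) = avg S (fun i => m (f i)).
Proof.
move=> mm bf; rewrite /avg -mean_sum// mulrC -meanZ//; last exact: bdd_sum.
by congr m; apply/funext => x; rewrite mulrC.
Qed.

Lemma avg_itv (R : realType) (I : choiceType) (S : {fset I}) (f : I -> R) :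
  S != fset0 -> (forall i, 0 <= f i <= 1) -> 0 <= avg S f <= 1.
Proof.
move=> S0 f01; have ma := @avg_mean R I S S0.
rewrite (mean_ge0 ma)/=; [|exact: bdd_unit|by move=> i; case/andP: (f01 i)].
rewrite -(mean1 ma); apply: mean_le => //; first exact: bdd_unit.
by move=> i; case/andP: (f01 i).
Qed.

(** * Pairwise correlations *)

(** If all late pairs had correlation at most [a ^+ 2 - e], a sum [w] of [k] of the
    functions would have [m (w ^+ 2)] at most about [k ^+ 2 * (a ^+ 2 - e)], against the
    Cauchy-Schwarz lower bound [(k * a) ^+ 2]. *)
Lemma large_correlation (R : realType) (X : Type) (m : (X -> R) -> R)
    (v : nat -> X -> R) (S : set nat) (a e : R) :
  is_mean m -> 0 <= a -> 0 < e -> (forall N x, 0 <= v N x <= 1) ->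
  (forall n, exists2 N, (n <= N)%N & S N) ->
  (forall N, S N -> a <= m (v N)) ->
  exists2 M, S M & forall n, exists2 N, (n <= N)%N &
    S N /\ a ^+ 2 - e < m (fun x => v M x * v N x).
Proof.
move=> mm a0 e0 v01 Sinf Sa; apply: contrapT => nex.
have bv N : bdd (v N) by exact: bdd_unit.
have H M : S M -> exists n, forall N, (n <= N)%N -> S N ->
    m (fun x => v M x * v N x) <= a ^+ 2 - e.
  move=> SM; apply: contrapT => /forallNP nM; apply: nex; exists M => // n.
  have /existsNP[N /not_implyP[nN /not_implyP[SN]]] := nM n.
  by move=> /negP; rewrite -ltNge => ?; exists N.
(* [w] is the sum of [k] functions chosen so that their pairwise correlations are
   small; past [n] any index in [S] can be chosen next *)
have sums k : exists w n, [/\ bdd w, k%:R * a <= m w,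
    m (fun x => w x ^+ 2) <= k%:R + (k%:R ^+ 2 - k%:R) * (a ^+ 2 - e) &
    forall N, (n <= N)%N -> S N ->
      m (fun x => w x * v N x) <= k%:R * (a ^+ 2 - e)].
  elim: k => [|k [w [n [bw wa w2 wv]]]].
    exists (fun=> 0), 0%N; split => //.
    - by rewrite mul0r mean0.
    - by under eq_fun do rewrite expr0n/=; rewrite mean0// expr0n/= subr0 mul0r addr0.
    - by move=> N _ _; under eq_fun do rewrite mul0r; rewrite mean0// mul0r.
  have [N nN SN] := Sinf n.
  have [n' Hn'] := H _ SN.
  exists (fun x => w x + v N x), (maxn n n'); split.
  - exact: bddD.
  - by rewrite meanD// -natr1 mulrDl mul1r lerD// Sa.
  - have -> : (fun x => (w x + v N x) ^+ 2) =
        (fun x => 2 * (w x * v N x) + (w x ^+ 2 + v N x ^+ 2)).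
      by apply/funext => x; ring.
    have bw2 : bdd (fun x => w x ^+ 2) by exact: bddM.
    have bv2 : bdd (fun x => v N x ^+ 2) by exact: bddM.
    have bwv : bdd (fun x => w x * v N x) by exact: bddM.
    rewrite (mean_linear mm)//; last exact: bddD.
    rewrite meanD//.
    have v1 : m (fun x => v N x ^+ 2) <= 1.
      rewrite -(mean1 mm); apply: mean_le => // x.
      by have /andP[? ?] := v01 N x; rewrite expr_le1.
    have := wv _ nN SN.
    rewrite -natr1; nra.
  - move=> N'; rewrite geq_max => /andP[nN' n'N'] SN'.
    under eq_fun do rewrite mulrDl.
    rewrite meanD//; [|exact: bddM|exact: bddM].
    by rewrite -natr1 mulrDl mul1r lerD ?wv ?Hn'.
(* the two bounds on [m (w ^+ 2)] give [(k - 1) * e <= 1 - a ^+ 2] *)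
pose k := (Num.truncn (1 + e^-1)).+1.
have kgt : 1 + e^-1 < k%:R :> R by exact: truncnS_gt.
have [w [_ [bw wa w2 _]]] := sums k.
have ka : (k%:R * a) ^+ 2 <= k%:R + (k%:R ^+ 2 - k%:R) * (a ^+ 2 - e).
  apply: le_trans w2; apply: le_trans (mean_sqr mm bw).
  by rewrite lerXn2r// nnegrE ?mulr_ge0//; apply: le_trans wa; rewrite mulr_ge0.
have k0 : 0 < k%:R :> R by rewrite ltr0n.
have : k%:R * ((k%:R - 1) * e) <= k%:R * (1 - a ^+ 2) by move: ka; nra.
rewrite ler_pM2l//; apply/negP; rewrite -ltNge.
have : e^-1 * e < (k%:R - 1) * e by rewrite ltr_pM2r//; lra.
rewrite mulVf ?gt_eqF// => ?; have := sqr_ge0 a; lra.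
Qed.

(** A weak form of the mean ergodic theorem: [phi] stands for the correlations of a
    stationary family [w], and the last hypothesis is what the almost invariance of
    [F] gives when a fixed [w c] is correlated with the members of [w] over [F N].
    The averages [v N] of [w] over [F N] have mean [a], and for fixed [M] and large
    [N] the correlation of [v M] and [v N] is close to the average of [phi] over
    [F N], so [large_correlation] applies to [v]. *)
Lemma large_average_correlation (R : realType) (X : Type) (I : choiceType)
    (m : (X -> R) -> R) (F : nat -> {fset I}) (w : I -> X -> R) (phi : I -> R)
    (a e : R) (n : nat) :
  is_mean m -> 0 <= a -> 0 < e -> (forall N, F N != fset0) ->
  (forall b x, 0 <= w b x <= 1) -> (forall b, m (w b) = a) ->
  (forall c, avg (F N) (fun b => m (fun x => w c x * w b x)) - avg (F N) phi
     @[N --> \oo] --> 0) ->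
  exists2 N, (n <= N)%N & a ^+ 2 - e < avg (F N) phi.
Proof.
move=> mm a0 e0 F0 w01 ma Fphi.
pose v N x := avg (F N) (w^~ x).
have e20 : 0 < e / 2 by rewrite divr_gt0.
have bw b : bdd (w b) by exact: bdd_unit.
have v01 N x : 0 <= v N x <= 1 by exact: avg_itv.
have bv N : bdd (v N) by exact: bdd_unit.
have [|N _|M _ pairs] := @large_correlation R X m v setT a (e / 2) mm a0 e20 v01.
- by move=> k; exists k.
- rewrite mean_avg//; under eq_fun do rewrite ma.
  by rewrite (mean_cst (avg_mean R (F0 N))).
pose u N := avg (F M) (fun c =>
  avg (F N) (fun b => m (fun x => w c x * w b x)) - avg (F N) phi).
have u0 : u N @[N --> \oo] --> 0.
  rewrite -(mul0r (#|`F M|%:R^-1 : R)); apply: cvgM; last exact: cvg_cst.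
  have := cvg_big (P := xpredT) (r := F M) (x0 := 0) (@add_continuous R) _
    (fun c _ => Fphi c).
  by rewrite big1_eq; exact.
have ww1 c b x : `|w c x * w b x| <= 1.
  have /andP[c0 c1] := w01 c x; have /andP[b0 b1] := w01 b x.
  by rewrite normrM !ger0_norm// mulr_ile1.
have bww c b : bdd (fun x => w c x * w b x) by exact: bddM.
have uE N : u N = m (fun x => v M x * v N x) - avg (F N) phi.
  have aM := avg_mean R (F0 M); have aN := avg_mean R (F0 N).
  have -> : (fun x => v M x * v N x) =
      fun x => avg (F M) (fun c => avg (F N) (fun b => w c x * w b x)).
    apply/funext => x; have bwx : bdd (w^~ x) by exact: bdd_unit.
    rewrite [LHS]mulrC -(meanZ aM)//; congr avg; apply/funext => c.
    by rewrite mulrC -(meanZ aN).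
  rewrite mean_avg//; last first.
    by move=> c; exists 1 => x; apply: (mean_norm aN).
  rewrite /u (meanB aM)// ?(mean_cst aM)//.
    by congr (avg _ _ - _); apply/funext => c; rewrite mean_avg.
  by exists 1 => c; apply: (mean_norm aN) => b; exact: (mean_norm mm).
move/cvgr0_norm_lt : u0 => /(_ _ e20)[k _ uk].
have [N kN [_ Mv]] := pairs (maxn n k).
exists N; first by rewrite (leq_trans _ kN)// leq_maxl.
have /= := uk N (leq_trans (leq_maxr _ _) kN).
rewrite uE ltr_norml => /andP[_]; lra.
Qed.

(** * Recurrence *)

(** Dependent choice along a decreasing sequence of good sets: step [i] intersects
    with [P (N i) i], and [x k] is a point of the set reached after step [k]. *)
Lemma nested_points (X : Type) (P : nat -> nat -> set X) (good : set (set X)) :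
  good setT -> (forall D, good D -> D !=set0) ->
  (forall D n, good D -> exists2 M, (n <= M)%N & good (D `&` P M n)) ->
  exists (N : nat -> nat) (x : nat -> X),
    (forall i, (i <= N i)%N) /\ forall i k, (i <= k)%N -> P (N i) i (x k).
Proof.
move=> goodT good0 step.
have /choice[g gP] : forall p : set X * nat, exists M,
    good p.1 -> (p.2 <= M)%N /\ good (p.1 `&` P M p.2).
  move=> [D n]; have [/(step _ n)[M nM gM]|] := pselect (good D); first by exists M.
  by exists 0%N.
pose fix D k := if k is k'.+1 then D k' `&` P (g (D k', k')) k' else [set: X].
have gD k : good (D k) by elim: k => //= k /(gP (D k, k)) [].
have /choice[x xD] := fun k => good0 _ (gD k.+1).
exists (fun i => g (D i, i)), x; split.
  by move=> i; have [] := gP (D i, i) (gD i).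
move=> i k ik.
have DS j l : (j <= l)%N -> D l `<=` D j.
  move/subnK => <-; elim: (l - j)%N => //= d IH; apply: subset_trans IH.
  exact: subIsetl.
by have [] := DS i.+1 k.+1 ik _ (xD k).
Qed.

(** A finitely additive substitute for the fact that some point has limit superior
    at least the limit superior of the means.  Either the negative parts of [f N - L]
    become small in mean along a subsequence, and then sets of positive mean can be
    cut down by [f M >= L - 1 / (n + 1)] with an arbitrarily small loss.  Or they keep
    a definite mean, which the positive parts must balance: then the sets
    [f N >= L] have mean bounded below for infinitely many [N], and
    [large_correlation] keeps this true after intersecting with one of them. *)
Lemma recurrent_points (R : realType) (X : Type) (m : (X -> R) -> R)
    (f : nat -> X -> R) (L : R) :
  is_mean m -> 0 <= L -> (forall N x, 0 <= f N x <= 1) ->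
  (forall e n, 0 < e -> exists2 N, (n <= N)%N & L - e < m (f N)) ->
  exists (N : nat -> nat) (x : nat -> X), (forall i, (i <= N i)%N) /\
    forall i k, (i <= k)%N -> L - i.+1%:R^-1 <= f (N i) (x k).
Proof.
move=> mm L0 f01 fL.
have bf N : bdd (f N) by exact: bdd_unit.
pose neg N x := Num.max (L - f N x) 0.
have bneg N : bdd (neg N).
  exists (L + 1) => x; have /andP[? ?] := f01 N x.
  by rewrite /neg ger0_norm ?le_max ?lexx ?orbT// ge_max; apply/andP; split; lra.
pose P M n := [set x | L - n.+1%:R^-1 <= f M x].
have [small|/existsNP[c /not_implyP[c0 /existsNP[n0 big]]]] := pselect
    (forall c, 0 < c -> forall n, exists2 N, (n <= N)%N & m (neg N) < c).
  apply: (@nested_points _ P (fun D => 0 < m \1_D)).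
  - have -> : \1_setT = (fun=> 1) :> (X -> R) by apply/funext => x; rewrite indicT.
    by rewrite mean1.
  - move=> D mD; have [|x] := mean_gt0_ex mm _ mD; first exact: bdd_indic.
    by rewrite indicE; have [/set_mem|] := boolP (x \in D); [exists x|rewrite ltxx].
  move=> D n mD.
  have n0 : 0 < n.+1%:R :> R by rewrite ltr0n.
  have [|M nM Mneg] := small (m \1_D / n.+1%:R) _ n; first by rewrite divr_gt0.
  exists M => //; move: Mneg; rewrite ltr_pdivlMr//.
  have : m \1_D <= m (fun x => n.+1%:R * neg M x + \1_(D `&` P M n) x).
    apply: mean_le => //; first by apply: bddD => //; exact: bddM.
    move=> x; rewrite !indicE in_setI.
    have neg0 : 0 <= neg M x by rewrite le_max lexx orbT.
    case: (x \in D) => /=; last by rewrite addr0 mulr_ge0.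
    have [_|nP] := boolP (x \in P M n); first by rewrite lerDr mulr_ge0.
    rewrite addr0 mulrC -ler_pdivrMr// mul1r.
    have : ~ P M n x by move/mem_set; rewrite (negbTE nP).
    move=> /negP; rewrite -ltNge ltrBrDr => /ltW fL1.
    by rewrite le_max lerBrDr addrC fL1.
  rewrite mean_linear//; move: (n.+1%:R) => t; lra.
have {}big N : (n0 <= N)%N -> c <= m (neg N).
  by move=> nN; rewrite leNgt; apply/negP => ?; apply: big; exists N.
pose Q N := [set x | L <= f N x].
apply: (@nested_points _ P (fun D => exists2 d, 0 < d &
    forall n, exists2 N, (n <= N)%N & d <= m \1_(D `&` Q N))).
- exists (c / 2); first by rewrite divr_gt0.
  move=> n; have [|N nN fN] := fL (c / 2) (maxn n n0); first by rewrite divr_gt0.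
  move: nN; rewrite geq_max => /andP[nN /big cN]; exists N => //.
  have : m (fun x => neg N x + f N x) <= m (fun x => L + \1_(setT `&` Q N) x).
    apply: mean_le => //; [exact: bddD|exact: bddD|move=> x].
    rewrite setTI indicE /neg; have /andP[? ?] := f01 N x.
    have [/set_mem|nQ] := boolP (x \in Q N).
      rewrite /Q/= => ?; rewrite max_r; last lra.
      by rewrite /=; lra.
    have : ~ Q N x by move/mem_set; rewrite (negbTE nQ).
    by move=> /negP; rewrite -ltNge => ?; rewrite max_l; rewrite /=; lra.
  rewrite !meanD// mean_cst//; lra.
- move=> D [d d0 /(_ 0%N)[N _ dN]].
  have [||x] := mean_gt0_ex mm (f := \1_(D `&` Q N));
    [exact: bdd_indic|exact: lt_le_trans d0 dN|].
  by rewrite indicE; have [/set_mem[]|] := boolP (x \in _); [exists x|rewrite ltxx].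
move=> D n [d d0 Dd].
have d20 : 0 < d ^+ 2 / 2 by rewrite divr_gt0// exprn_gt0.
have [||||M [nM _] MP] := @large_correlation R X m (fun N => \1_(D `&` Q N))
    [set N | (n <= N)%N /\ d <= m \1_(D `&` Q N)] d (d ^+ 2 / 2) mm _ d20.
- exact: ltW.
- by move=> N x; exact: indic_itv.
- move=> k; have [N kN dN] := Dd (maxn n k).
  by move: kN; rewrite geq_max => /andP[? ?]; exists N.
- by move=> N [].
exists M => //; exists (d ^+ 2 / 2) => // k.
have [N kN [_ dN]] := MP k; exists N => //.
have {dN} : d ^+ 2 / 2 <= m (fun x => \1_(D `&` Q M) x * \1_(D `&` Q N) x) by lra.
move/le_trans; apply; apply: mean_le => //; first exact: bddM.
move=> x; rewrite !indicE !in_setI.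
have : x \in Q M -> x \in P M n.
  move=> /set_mem QM; apply/mem_set; apply: le_trans QM.
  by rewrite lerBlDr lerDl invr_ge0.
case: (x \in D) => /=; last by rewrite mul0r.
case: (x \in Q M) => [->//|_] /=; last by rewrite mul0r.
by rewrite mul1r.
Qed.

(** * Limits along ultrafilters on the natural numbers *)

(** Limits along [U] replace the passage to a subsequence of [S]. *)
Lemma frequent_ultrafilter (S : set nat) :
  (forall n, exists2 N, (n <= N)%N & S N) ->
  exists U : set_system nat, [/\ UltraFilter U, \oo `<=` U & U S].
Proof.
move=> Sinf.
have PF : ProperFilter (within S \oo).
  apply: Build_ProperFilter_ex => P [n _ nP].
  by have [N nN SN] := Sinf n; exists N; exact: nP.
have [U [UU FU]] := ultraFilterLemma PF; exists U; split=> //.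
- by move=> P ooP; apply: FU; exact: filterS ooP.
- by apply: FU; exists 0%N.
Qed.

(** A finite set only tests finitely many membership statements, and each of these is
    decided by the ultrafilter. *)
Lemma ultra_limit_set (R : realType) (I : Type) (U : set_system I) (X : choiceType)
    (E : I -> set X) (S : {fset X}) : UltraFilter U ->
  U [set k | avg S (\1_[set x | U [set i | E i x]]) = avg S \1_(E k) :> R].
Proof.
move=> UU; pose B := [set x | U [set i | E i x]]; rewrite -/B.
have agree x : U [set k | E k x <-> B x].
  have [Bx|nBx] := pselect (U [set k | E k x]).
    by apply: filterS (Bx) => k Ekx; split=> _; [exact: Bx|exact: Ekx].
  have [//|] := in_ultra_setVsetC [set k | E k x] UU.
  by apply: filterS => k nE; split=> [/nE|/nBx].
have : U (\bigcap_(x in [set` S]) [set k | E k x <-> B x]).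
  by apply: filter_bigI => x _; exact: agree.
apply: filterS => k Sk; rewrite /avg /=; congr (_ / _).
apply: eq_big_seq => x /Sk EB; rewrite !indicE; congr (nat_of_bool _)%:R.
by apply/idP/idP => /set_mem ?; apply/mem_set/EB.
Qed.

(** * Upper densities *)

Section UpperDensity.
Variables (R : realType) (G : groupType) (F : nat -> {fset G}) (E : set G).

Lemma upper_densityE :
  upper_density R F E = limn_esup (fun N => (avg (F N) (\1_E : G -> R))%:E).
Proof.
congr limn_esup; apply/funext => N; congr EFin; rewrite /avg; congr (_ / _).
rewrite -sum1_size natr_sum -big_fset_condE big_mkcond/=.
by apply: eq_bigr => x _; rewrite indicE; case: (x \in E).
Qed.

Lemma upper_density_frequently (t : R) : (t%:E < upper_density R F E)%E ->
  forall n, exists2 N, (n <= N)%N & t < avg (F N) \1_E.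
Proof.
rewrite upper_densityE => tE n; apply: contrapT => nN.
move: tE; apply/negP; rewrite -leNgt; apply: ge_ereal_inf.
exists (ereal_sup [set (avg (F N) (\1_E : G -> R))%:E | N in [set N | (n <= N)%N]]).
  by exists [set N | (n <= N)%N] => //; exists n.
apply: ge_ereal_sup => _ [N nN' <-]; rewrite lee_fin leNgt.
by apply/negP => ?; apply: nN; exists N.
Qed.

Lemma ge_upper_density (t : R) :
  (forall e n, 0 < e -> exists2 N, (n <= N)%N & t - e <= avg (F N) \1_E) ->
  (t%:E <= upper_density R F E)%E.
Proof.
move=> tE; rewrite upper_densityE; apply: le_ereal_inf_tmp => _ [V [n _ nV] <-].
apply/lee_addgt0Pr => e e0; rewrite -leeBlDr//.
have [N nN tN] := tE e n e0.
apply: le_trans (ereal_sup_ubound _); last by exists N; [exact: nV|reflexivity].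
by rewrite -EFinB lee_fin.
Qed.

Lemma upper_density_le1 : (forall N, F N != fset0) -> (upper_density R F E <= 1)%E.
Proof.
move=> F0; rewrite upper_densityE; apply: ge_ereal_inf.
exists (ereal_sup [set (avg (F N) (\1_E : G -> R))%:E | N in setT]).
  by exists setT => //; exact: filterT.
apply: ge_ereal_sup => _ [N _ <-]; rewrite lee_fin.
by have /andP[] := avg_itv (F0 N) (indic_itv R E).
Qed.

End UpperDensity.

(** * Følner sequences *)

Lemma sum_norm_le (R : realType) (X : choiceType) (S : {fset X}) (f : X -> R) C :
  (forall x, `|f x| <= C) -> `|\sum_(x <- S) f x| <= C * #|`S|%:R.
Proof.
move=> fC; rewrite (le_trans (ler_norm_sum _ _ _))//.
rewrite (le_trans (ler_sum _ (fun x _ => fC x)))//.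
by rewrite big_const_seq count_predT iter_addr_0 mulr_natr.
Qed.

Lemma sum_fsymdiff (R : realType) (X : choiceType) (S T : {fset X}) (f : X -> R) C :
  (forall x, `|f x| <= C) ->
  `|\sum_(x <- S) f x - \sum_(x <- T) f x| <= C * #|`fsymdiff S T|%:R.
Proof.
move=> fC.
rewrite (big_fsetID _ (mem T) S) (big_fsetID _ (mem S) T)/=.
have -> : [fset x in S | x \in T]%fset = [fset x in T | x \in S]%fset.
  by apply/fsetP => x; rewrite !inE andbC.
rewrite opprD addrACA subrr add0r (le_trans (ler_normB _ _))//.
have -> : [fset x in S | x \notin T]%fset = (S `\` T)%fset.
  by apply/fsetP => x; rewrite !inE andbC.
have -> : [fset x in T | x \notin S]%fset = (T `\` S)%fset.
  by apply/fsetP => x; rewrite !inE andbC.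
rewrite /fsymdiff cardfsU.
have -> : ((S `\` T) `&` (T `\` S))%fset = fset0.
  by apply/fsetP => x; rewrite !inE; case: (x \in S); case: (x \in T).
by rewrite cardfs0 subn0 natrD mulrDr lerD// sum_norm_le.
Qed.

(** A common form of the left and right Følner conditions, with [h] the translation. *)
Lemma avg_shift_cvg (R : realType) (X : choiceType) (F : nat -> {fset X})
    (h : X -> X) (f : X -> R) : injective h -> bdd f ->
  (#|`fsymdiff [fset h x | x in F N]%fset (F N)|%:R / #|`F N|%:R : R)
    @[N --> \oo] --> (0 : R) ->
  avg (F N) (f \o h) - avg (F N) f @[N --> \oo] --> 0.
Proof.
move=> hinj [C fC] F0; apply: norm_cvg0.
apply: (@squeeze_cvgr _ _ _ _ (fun=> 0)
  (fun N => C * (#|`fsymdiff [fset h x | x in F N]%fset (F N)|%:R / #|`F N|%:R))).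
- apply: filterE => N; rewrite normr_ge0/= /avg -mulrBl normrM mulrA.
  rewrite [X in _ * X]ger0_norm ?invr_ge0// ler_wpM2r ?invr_ge0//.
  have -> : \sum_(x <- F N) (f \o h) x = \sum_(x <- [fset h x | x in F N]%fset) f x.
    by rewrite big_imfset//= => x y _ _; exact: hinj.
  exact: sum_fsymdiff.
- exact: cvg_cst.
- by rewrite -(mulr0 C); apply: cvgM => //; exact: cvg_cst.
Qed.

Definition left_invariant (R : realType) (G : groupType) (m : (G -> R) -> R) : Prop :=
  forall (g : G) (f : G -> R), bdd f -> m (fun x => f (g * x)%g) = m f.

(** The mean is the limit of the averages over [F N] along an ultrafilter that
    concentrates on the indices [N] where [E] has density above [t] in [F N]. *)
Lemma left_Folner_mean (R : realType) (G : groupType) (F : nat -> {fset G})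
    (E : set G) (t : R) : left_Folner R F -> (t%:E < upper_density R F E)%E ->
  exists m : (G -> R) -> R, [/\ is_mean m, left_invariant m & t <= m \1_E].
Proof.
move=> [F0 FF] /upper_density_frequently/frequent_ultrafilter[U [UU ooU UE]].
have mF N := avg_mean R (F0 N).
exists (fun f => ulim U (fun N => avg (F N) f)); split.
- exact: ulim_mean.
- move=> g f bf; apply: ulim_eq.
  have bavg : bdd (fun N => avg (F N) f).
    by have [C fC] := bf; exists C => N; exact: (mean_norm (mF N)).
  have -> : (fun N => avg (F N) (fun x => f (g * x)%g)) =
      fun N => (avg (F N) (f \o *%g g) - avg (F N) f) + avg (F N) f.
    by apply/funext => N; rewrite subrK.
  rewrite -[X in _ --> X]add0r.
  apply: cvgD; last exact: cvg_ulim.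
  apply: cvg_trans (avg_shift_cvg (@mulgI G g) bf (FF g)).
  by move=> P; exact: ooU.
- apply: limr_ge.
    apply: (cvgP (ulim U (fun N => avg (F N) (\1_E : G -> R)))).
    apply: cvg_ulim; exists 1 => N; apply: (mean_norm (mF N)) => x.
    by have /andP[? ?] := indic_itv R E x; rewrite ger0_norm.
  by apply: filterS UE => N /ltW.
Qed.

(** The supremum over Følner sequences need not come with an obvious maximizer, but a
    second ultrafilter limit, now of invariant means that nearly realize it, loses
    nothing. *)
Lemma left_upper_Banach_density_mean (R : realType) (G : groupType) (E : set G)
    (d : R) : left_upper_Banach_density R E = d%:E ->
  exists m : (G -> R) -> R, [/\ is_mean m, left_invariant m & d <= m \1_E].
Proof.
move=> dE.
have /choice[m mP] : forall n, exists m : (G -> R) -> R,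
    [/\ is_mean m, left_invariant m & d - n.+1%:R^-1 <= m \1_E].
  move=> n.
  have : ((d - n.+1%:R^-1)%:E < left_upper_Banach_density R E)%E.
    by rewrite dE lte_fin ltrBlDr ltrDl invr_gt0.
  by move=> /ereal_sup_gt[_ [F FF <-]]; exact: left_Folner_mean.
have [|U [UU ooU _]] := @frequent_ultrafilter setT; first by move=> n; exists n.
have bm f : bdd f -> bdd (fun n => m n f).
  by move=> [C fC]; exists C => n; apply: mean_norm => //; have [] := mP n.
exists (fun f => ulim U (fun n => m n f)); split.
- by apply: ulim_mean => n; have [] := mP n.
- by move=> g f bf; congr ulim; apply/funext => n; have [_ ->] := mP n.
- have dU : (d - n.+1%:R^-1) @[n --> U] --> d.
    rewrite -[X in _ --> X]subr0; apply: cvgB; first exact: cvg_cst.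
    by apply: cvg_trans (@cvg_harmonic R) => P; exact: ooU.
  have mU := cvg_ulim UU (bm _ (bdd_indic R E)).
  by apply: ler_cvg_to dU mU _; apply: filterE => n; have [] := mP n.
Qed.

(** * Sets of returns *)

(** The two conditions move the base point in different coordinates, so that the
    quotient of a point of the first kind by one of the second kind does not depend on
    [x]; the inverse in the second makes that quotient a point of the square. *)
Definition returns (G : groupType) (A : set (G * G)%type) (x : G * G) : set G :=
  [set b | A ((b, 1) * x)%g /\ A ((1, b^-1) * x)%g].

Lemma returns_AAinv (G : groupType) (A : set (G * G)%type) x b1 b2 :
  returns A x b1 -> returns A x b2 -> AAinv A (b1, b2).
Proof.
move=> [Ab1 _] [_ Ab2].
exists ((b1, 1) * x)%g => //; exists ((1, b2^-1) * x)%g => //.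
have e1 : (b1 * x.1 * (1 * x.1)^-1 = b1)%g by rewrite mul1g mulgK.
have e2 : (1 * x.2 * (b2^-1 * x.2)^-1 = b2)%g by rewrite mul1g invgM mulVKg invgK.
by rewrite -{2}e1 -{2}e2.
Qed.

(** The change of variable [x := (1, b) * x] expresses the mean of a return as a
    correlation for the diagonal action. *)
Lemma returns_shift (G : groupType) (A : set (G * G)%type) x b :
  returns A ((1, b) * x)%g b <-> (A `&` [set y | A ((b, b) * y)%g]) x.
Proof.
have e1 : ((b, 1) * ((1, b) * x) = (b, b) * x)%g.
  by congr pair => /=; rewrite !mul1g.
have e2 : ((1, b^-1) * ((1, b) * x) = x)%g.
  by case: x {e1} => x1 x2; congr pair => /=; rewrite ?mul1g ?mulKg.
by rewrite /returns /= e1 e2; split=> -[].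
Qed.

Theorem theorem1p16 (R : realType) (G : groupType)
  (Gcountable : countably_infinite G) (Gamenable : amenable R G)
  (A : set (G * G)%type)
  (dA_gt0 : (0 < left_upper_Banach_density R A)%E) :
  forall F : nat -> {fset G}, left_Folner R F \/ right_Folner R F ->
  exists B : set G,
    (left_upper_Banach_density R A ^+ 2 <= upper_density R F B)%E /\
    B `*` B `<=` AAinv A.
Proof.
move=> F FF.
have F0 N : F N != fset0 by case: FF => -[F0 _].
have dA_le1 : (left_upper_Banach_density R A <= 1)%E.
  by apply: ge_ereal_sup => _ [Phi [Phi0 _] <-]; exact: upper_density_le1.
have [d dE] : exists d : R, left_upper_Banach_density R A = d%:E.
  exists (fine (left_upper_Banach_density R A)); rewrite fineK// ge0_fin_numE.
    exact: le_lt_trans dA_le1 (ltry _).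
  exact: ltW.
have d0 : 0 <= d by rewrite -lee_fin -dE ltW.
have [m [mm minv dm]] := left_upper_Banach_density_mean dE.
set a := m \1_A in dm.
have a0 : 0 <= a := le_trans d0 dm.
pose phi b : R := m (fun x => \1_A x * \1_A ((b, b) * x)%g).
have bA g : bdd (fun x => \1_A (g * x)%g : R) by exact: bdd_comp.
pose f N x : R := avg (F N) \1_(returns A x).
have f01 N x : 0 <= f N x <= 1 by apply: avg_itv => // b; exact: indic_itv.
have bret b : bdd (fun x => \1_(returns A x) b : R).
  by apply: bdd_unit => x; exact: indic_itv.
have retphi b : m (fun x => \1_(returns A x) b) = phi b.
  rewrite -(minv (1, b)%g)//; congr m; apply/funext => x.
  have -> : (\1_(returns A ((1, b) * x)%g) b : R) =
      \1_(A `&` [set y | A ((b, b) * y)%g]) x.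
    have [shiftl shiftr] := returns_shift A x b.
    by rewrite !indicE; congr (nat_of_bool _)%:R;
      apply/idP/idP => /set_mem; [move/shiftl|move/shiftr]; exact: mem_set.
  by rewrite indicI.
have mf N : m (f N) = avg (F N) phi.
  by rewrite mean_avg//; congr avg; apply/funext.
have bphi : bdd phi.
  exists 1 => b; apply: (mean_norm mm) => x.
  have /andP[? ?] := indic_itv R A x.
  have /andP[? ?] := indic_itv R A ((b, b) * x)%g.
  by rewrite normrM !ger0_norm// mulr_ile1.
have ergodic e n : 0 < e -> exists2 N, (n <= N)%N & a ^+ 2 - e < m (f N).
  move=> e0; suff [N nN aN] : exists2 N, (n <= N)%N & a ^+ 2 - e < avg (F N) phi.
    by exists N; rewrite ?mf.
  case: FF => -[_ FF].
  (* inverses make the correlation of [w c] and [w b] equal to [phi (c^-1 * b)], a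
     left shift of [phi]; without them it is the right shift [phi (b * c^-1)] *)
  - apply: (@large_average_correlation _ _ _ m F
      (fun b x => \1_A ((b^-1, b^-1) * x)%g)) => //.
    + by move=> b x; exact: indic_itv.
    + by move=> b; exact: minv.
    + move=> c; rewrite (_ : (fun b => m _) = phi \o *%g (c^-1)%g).
        exact: avg_shift_cvg (@mulgI G (c^-1)%g) bphi (FF (c^-1)%g).
      apply/funext => b; rewrite -(minv (b, b)%g); last exact: bddM.
      congr m; apply/funext => x; rewrite mulrC; congr (\1_A _ * \1_A _).
        by case: x => x1 x2; congr pair => /=; rewrite mulKg.
      by congr pair => /=; rewrite mulgA.
  - apply: (@large_average_correlation _ _ _ m F
      (fun b x => \1_A ((b, b) * x)%g)) => //.
    + by move=> b x; exact: indic_itv.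
    + by move=> b; exact: minv.
    + move=> c; rewrite (_ : (fun b => m _) = phi \o *%g^~ (c^-1)%g).
        exact: avg_shift_cvg (@mulIg G (c^-1)%g) bphi (FF (c^-1)%g).
      apply/funext => b; rewrite -(minv (c^-1, c^-1)%g); last exact: bddM.
      congr m; apply/funext => x; congr (\1_A _ * \1_A _).
        by case: x => x1 x2; congr pair => /=; rewrite mulVKg.
      by congr pair => /=; rewrite mulgA.
have [//||N [x [iN Nx]]] := @recurrent_points R _ m f (a ^+ 2) mm _ f01.
- exact: exprn_ge0.
- by move=> e n; exact: ergodic.
have [|U [UU ooU _]] := @frequent_ultrafilter setT; first by move=> n; exists n.
exists [set b | U [set k | returns A (x k) b]]; split; last first.
  move=> [b1 b2] [/= Ub1 Ub2].
  have [k [kb1 kb2]] := filter_ex (filterI Ub1 Ub2).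
  exact: returns_AAinv kb1 kb2.
rewrite dE -EFin_expe.
have /le_trans : ((d ^+ 2)%:E <= (a ^+ 2)%:E)%E by rewrite lee_fin lerXn2r.
apply.
apply: ge_upper_density => e n e0.
pose i := maxn n (Num.truncn e^-1).
exists (N i); first by rewrite (leq_trans _ (iN i))// leq_maxl.
have Ui : U [set k | (i <= k)%N] by apply: ooU; exists i.
have [k [ik /= ->]] := filter_ex (filterI Ui
  (ultra_limit_set R (fun k => returns A (x k)) (F (N i)) UU)).
apply: le_trans (Nx i k ik); rewrite lerB// invf_ple ?posrE//.
by rewrite (le_trans (ltW (truncnS_gt _)))// ler_nat ltnS leq_maxr.
Qed.
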